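(* Let $\Omega$ be a non-empty compact metrizable space and $\tau$ an action of $\mathbb{Z}^l$ or of $(\mathbb{N}\cup\{0\})^l$ on $\Omega$ by continuous maps, for some $l\in\mathbb{N}$, such that the measure-theoretic entropy $h^\tau$ is finite and upper semi-continuous on $\mathcal{M}^\tau(\Omega)$. Let $f\in C(\Omega)$. Assume that there exists a vector subspace $V\subset C(\Omega)$, dense in $C(\Omega)$ for the uniform topology, such that $f+g$ has a unique equilibrium state for every $g\in V$. Then for each $\mu\in\mathcal{M}^\tau(\Omega)$ there exists a sequence $(\mu_n,g_n)_{n\in\mathbb{N}}$ in $\mathcal{M}^\tau(\Omega)\times V$ such that $\mu_n\to\mu$ in the weak-$*$ topology, $h^\tau(\mu_n)\to h^\tau(\mu)$, and for every $n$, $\mu_n$ is the (unique) equilibrium state for $f+g_n$.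
   Context: $C(\Omega)$ is the space of real-valued continuous functions on $\Omega$ with the uniform topology; $\mathcal{M}(\Omega)$ is the set of Borel probability measures on $\Omega$ with the weak-$*$ topology; $\mathcal{M}^\tau(\Omega)$ is the (compact) subset of $\tau$-invariant elements; $h^\tau(\mu)$ is the measure-theoretic entropy of $\mu\in\mathcal{M}^\tau(\Omega)$ for the action $\tau$. The pressure is $P^\tau(g)=\sup_{\mu\in\mathcal{M}^\tau(\Omega)}\{\mu(g)+h^\tau(\mu)\}$ for $g\in C(\Omega)$ (variational principle), where $\mu(g)=\int g\,d\mu$; an equilibrium state for $g$ is a $\mu\in\mathcal{M}^\tau(\Omega)$ attaining this supremum (which is a maximum under the standing assumptions). *)

(* Defs.v *)
From HB Require Import structures.
From mathcomp Require Import all_boot all_order all_algebra.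
From mathcomp Require Import all_classical all_reals all_analysis.

Set Implicit Arguments.
Unset Strict Implicit.
Unset Printing Implicit Defensive.

Import Order.TTheory GRing.Theory Num.Def Num.Theory.
Import numFieldTopology.Exports.

Local Open Scope classical_set_scope.
Local Open Scope ring_scope.

Inductive acting_monoid := ZZ | NN.

Definition amon_carrier (k : acting_monoid) : Type :=
  match k with ZZ => int | NN => nat end.

Definition amon_add (k : acting_monoid) :
  amon_carrier k -> amon_carrier k -> amon_carrier k :=
  match k return amon_carrier k -> amon_carrier k -> amon_carrier k with
  | ZZ => fun a b : int => (a + b)%R
  | NN => addn
  end.

Definition amon_of_nat (k : acting_monoid) (n : nat) : amon_carrier k :=
  match k return amon_carrier k with ZZ => (n%:Z)%R | NN => n end.

Definition lat (k : acting_monoid) (l : nat) : Type := 'I_l -> amon_carrier k.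

Definition lat_add k l (a b : lat k l) : lat k l := fun i => amon_add (a i) (b i).
Definition lat_zero k l : lat k l := fun _ => amon_of_nat k 0.

Definition box_pt k l n (a : {ffun 'I_l -> 'I_n}) : lat k l :=
  fun i => amon_of_nat k (a i).

Definition is_action (T : topologicalType) k l (tau : lat k l -> T -> T) : Prop :=
  [/\ (forall a, continuous (tau a)),
      (forall x, tau (@lat_zero k l) x = x) &
      (forall a b x, tau (lat_add a b) x = tau a (tau b x))].

Definition borel (T : ptopologicalType) := g_sigma_algebraType (@open T).

Section Thermo.
Variables (R : realType) (T : ptopologicalType) (k : acting_monoid) (l : nat)
  (tau : lat k l -> T -> T).

Local Notation B := (borel T).
Local Notation prob := (probability B R).

Definition pairing (mu : prob) (g : T -> R) : \bar R :=
  (\int[mu]_x (g x)%:E)%E.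

Definition tau_invariant (mu : prob) : Prop :=
  forall (a : lat k l) (A : set B), measurable A ->
    mu ((tau a) @^-1` A) = mu A.

Definition meas_partition (s : seq (set B)) : Prop :=
  [/\ (forall i, (i < size s)%N -> measurable (nth set0 s i)),
      (forall i j, (i < size s)%N -> (j < size s)%N -> i <> j ->
          nth set0 s i `&` nth set0 s j = set0) &
      (forall x : T, exists2 i, (i < size s)%N & nth set0 s i x)].

Definition entf (x : R) : R := if x == 0 then 0 else - (x * ln x).

(* H_mu of the join of tau_a^{-1} s over a in [0,n)^l : the atoms of the join
   are indexed by the maps c from the box to the indices of s *)
Definition join_entropy (mu : prob) (s : seq (set B)) (n : nat) : R :=
  \sum_(c : {ffun {ffun 'I_l -> 'I_n} -> 'I_(size s)})
     entf (fine (mu (\bigcap_(a in [set: {ffun 'I_l -> 'I_n}])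
                       ((tau (@box_pt k l n a)) @^-1` (nth set0 s (c a)))))).

(* h_mu(tau, s) = lim_n H_mu(s^{[0,n)^l}) / n^l  (limit exists; limsup taken) *)
Definition partition_entropy (mu : prob) (s : seq (set B)) : \bar R :=
  limn_esup (fun n => (join_entropy mu s n / ((n ^ l)%N)%:R)%:E).

Definition ms_entropy (mu : prob) : \bar R :=
  ereal_sup [set partition_entropy mu s | s in meas_partition].

(* pressure P^tau(g) via the variational principle *)
Definition pressure (g : T -> R) : \bar R :=
  ereal_sup [set (pairing mu g + ms_entropy mu)%E | mu in tau_invariant].

Definition equilibrium_state (g : T -> R) (mu : prob) : Prop :=
  tau_invariant mu /\ (pairing mu g + ms_entropy mu)%E = pressure g.

Definition unique_equilibrium_state (g : T -> R) : Prop :=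
  exists mu : prob, equilibrium_state g mu /\
    forall nu : prob, equilibrium_state g nu ->
      forall A : set B, measurable A -> nu A = mu A.

(* upper semi-continuity of h^tau on M^tau for the weak-* topology,
   using the basic weak-* neighbourhoods of mu *)
Definition entropy_usc : Prop :=
  forall mu : prob, tau_invariant mu -> forall c : R, (ms_entropy mu < c%:E)%E ->
    exists (m : nat) (gs : 'I_m -> T -> R) (e : R),
      [/\ 0 < e, (forall i, continuous (gs i)) &
        forall nu : prob, tau_invariant nu ->
          (forall i, (`| pairing nu (gs i) - pairing mu (gs i) | < e%:E)%E) ->
          (ms_entropy nu < c%:E)%E].

Definition weak_star_cvg (mu_ : nat -> prob) (mu : prob) : Prop :=
  forall g : T -> R, continuous g ->
    (fun n => pairing (mu_ n) g) @ \oo --> pairing mu g.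

End Thermo.

Definition dense_subspace_C (R : realType) (T : topologicalType)
  (V : set (T -> R)) : Prop :=
  [/\ V (fun _ => 0),
      (forall g h, V g -> V h -> V (fun x => g x + h x)),
      (forall (a : R) g, V g -> V (fun x => a * g x)),
      (forall g, V g -> continuous g) &
      (forall g, continuous g -> forall e : R, 0 < e ->
         exists2 v, V v & forall x, `| g x - v x | < e)].

(* Main.v *)
Require Import Defs.
From HB Require Import structures.
From mathcomp Require Import all_boot all_order all_algebra.
From mathcomp Require Import all_classical all_reals all_analysis.
From mathcomp Require Import measurable_realfun finmap ring lra.
Set Implicit Arguments.
Unset Strict Implicit.
Unset Printing Implicit Defensive.

Import Order.TTheory GRing.Theory Num.Def Num.Theory.
Import numFieldTopology.Exports.
Local Open Scope classical_set_scope.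
Local Open Scope ring_scope.

(** Write [P] for the pressure, [mu_v] for the equilibrium state of [f + v], and
fix an invariant [mu] and [g_1, ..., g_m] in [V].  The function
[c |-> P (f + sum_i c_i g_i) - sum_i c_i mu(g_i) + |c|^2 / (2 lm)]
is continuous and coercive on [R^m], so it has a minimizer [c].  By weak-*
compactness, upper semi-continuity of the entropy and uniqueness of equilibrium
states, [P] is differentiable at [f + v] along [V] with derivative
[w |-> mu_v(w)]; hence [nu := mu_v], for [v := sum_i c_i g_i], satisfies
[nu(g_i) = mu(g_i) - c_i / lm].  Comparing the minimum with the value at [0]
shows that [c_i / lm] tends to [0] as [lm] grows, and comparing [nu] with [mu]
in the variational principle for [f + v] gives
[nu(f) + h(nu) >= mu(f) + h(mu)].  Thus [nu] is weak-* close to [mu], the last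
inequality bounds [h(nu)] from below and upper semi-continuity bounds it from
above.  Only finitely many [g_i] matter at each stage because finite partitions
of unity of mesh [1/(n+1)] control all continuous functions in the limit.

Weak-* compactness is obtained by taking the limit of a family of probabilities
along an ultrafilter, which is a content on closed sets, and turning it into a
Borel measure by inner and outer regularization and Caratheodory's theorem. *)

(** * Measures from contents on closed sets *)

Section content_outer_measure.
Context {R : realType} {T : ptopologicalType} (lam : set T -> R).
Hypothesis normalT : normal_space T.
Hypothesis compactT : compact [set: T].
Hypothesis le_lam : forall K L, closed K -> closed L -> K `<=` L -> lam K <= lam L.
Hypothesis lamU_le : forall K L, closed K -> closed L ->
  lam (K `|` L) <= lam K + lam L.
Hypothesis lamU : forall K L, closed K -> closed L -> K `&` L = set0 ->
  lam (K `|` L) = lam K + lam L.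
Local Open Scope ereal_scope.

(** Two-step regularization: values on closed sets are carried to open sets from inside, then to
    arbitrary sets from outside. It is needed because [lam], being only finitely additive, need not
    be the restriction of a measure. *)
Definition inner_content (U : set T) : \bar R :=
  ereal_sup [set (lam K)%:E | K in [set K | closed K /\ K `<=` U]].

Definition outer_content (A : set T) : \bar R :=
  ereal_inf [set inner_content U | U in [set U | open U /\ A `<=` U]].

Let lam0 : lam set0 = 0%R.
Proof.
have := @lamU set0 set0 closed0 closed0 (setI0 _); rewrite setU0 => h.
by apply: (addrI (lam set0)); rewrite addr0 -h.
Qed.

Lemma inner_content_ub U K : closed K -> K `<=` U -> (lam K)%:E <= inner_content U.
Proof. by move=> cK KU; apply: ereal_sup_ubound; exists K. Qed.

Lemma inner_content_ge0 U : 0 <= inner_content U.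
Proof. by rewrite -[0]/(0%R%:E) -lam0; apply: inner_content_ub => //; exact: closed0. Qed.

Lemma le_inner_content U V : U `<=` V -> inner_content U <= inner_content V.
Proof.
move=> UV; apply: ge_ereal_sup => _ [K [cK KU] <-].
by apply: inner_content_ub => //; exact: subset_trans UV.
Qed.

Lemma inner_content_le U : inner_content U <= (lam setT)%:E.
Proof.
apply: ge_ereal_sup => _ [K [cK KU] <-]; rewrite lee_fin.
by apply: le_lam => //; exact: closedT.
Qed.

Lemma inner_content_fin U : inner_content U \is a fin_num.
Proof.
rewrite ge0_fin_numE ?inner_content_ge0//.
by apply: le_lt_trans (inner_content_le U) _; rewrite ltry.
Qed.

Lemma inner_content0 : inner_content set0 = 0.
Proof.
apply/eqP; rewrite eq_le inner_content_ge0 andbT.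
by apply: ge_ereal_sup => _ [K [cK K0] <-]; move: K0; rewrite subset0 => ->; rewrite lam0.
Qed.

(** For closed [K] inside the union, the closed sets [K] minus [U] and [K] minus [V] are disjoint.
    Separating them by disjoint open sets [W1], [W2] covers [K] by closed pieces, one inside [U] and
    one inside [V]. *)
Lemma inner_contentU U V : open U -> open V ->
  inner_content (U `|` V) <= inner_content U + inner_content V.
Proof.
move=> oU oV; apply: ge_ereal_sup => _ [K [cK KUV] <-].
have cl W : open W -> closed (K `&` ~` W).
  by move=> oW; apply: closedI => //; exact: open_closedC.
have [|W1 [W2 [oW1 oW2 KW1 KW2 W12]]] :=
  (@normal_openP R T).1 normalT _ _ (cl _ oU) (cl _ oV).
  by rewrite -subset0 => x [[/KUV[Ux|Vx] ?] [_ ?]].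
apply: (@le_trans _ _ ((lam (K `&` ~` W1))%:E + (lam (K `&` ~` W2))%:E)).
  rewrite -EFinD lee_fin (le_trans _ (lamU_le (cl _ oW1) (cl _ oW2)))//.
  apply: le_lam => //; first by apply: closedU; exact: cl.
  move=> x Kx; have [W1x|] := pselect (W1 x); last by left.
  by right; split => // W2x; suff : set0 x by []; rewrite -W12.
apply: leeD; (apply: inner_content_ub; first exact: cl) => x [Kx nO].
- by apply: contrapT => nU; apply: nO; exact: KW1.
- by apply: contrapT => nV; apply: nO; exact: KW2.
Qed.

(** A closed subset of the union is compact, so finitely many [U n] cover it and finite
    subadditivity suffices. *)
Lemma inner_content_bigcup (U : nat -> set T) : (forall n, open (U n)) ->
  inner_content (\bigcup_n U n) <= \sum_(n <oo) inner_content (U n).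
Proof.
move=> oU; apply: ge_ereal_sup => _ [K [cK KU] <-].
have /(subclosed_compact cK)/(_ (subsetT _)) := compactT.
rewrite compact_cover => /(_ nat setT U (fun n _ => oU n) KU)[D _ KD].
have fin n : inner_content (\big[setU/set0]_(i < n) U i) <=
    \sum_(0 <= i < n) inner_content (U i).
  elim: n => [|n ih]; first by rewrite big_ord0 big_geq// inner_content0.
  rewrite big_ord_recr big_nat_recr//=; apply: le_trans (inner_contentU _ _) _ => //.
    by rewrite -bigcup_mkord; apply: bigcup_open.
  exact: leeD2r.
pose N := (\max_(i <- enum_fset D) i).+1.
apply: le_trans (le_trans (fin N) _); last first.
  by apply: nneseries_lim_ge => n _ _; exact: inner_content_ge0.
apply: inner_content_ub => // x /KD[i /= iD Uix].
rewrite -bigcup_mkord; exists i => //=.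
by rewrite /N ltnS; apply: (@leq_bigmax_seq _ _ _ id).
Qed.

Lemma outer_content_open U : open U -> outer_content U = inner_content U.
Proof.
move=> oU; apply/eqP; rewrite eq_le; apply/andP; split.
  by apply: ereal_inf_lbound; exists U => //; split.
by apply: le_ereal_inf_tmp => _ [V [oV UV] <-]; exact: le_inner_content.
Qed.

Let outer_ge0 A : 0 <= outer_content A.
Proof. by apply: le_ereal_inf_tmp => _ [V _ <-]; exact: inner_content_ge0. Qed.

Let outer_fin A : outer_content A \is a fin_num.
Proof.
rewrite ge0_fin_numE//; apply: (@le_lt_trans _ _ (inner_content setT)).
  by apply: ereal_inf_lbound; exists setT => //; split => //; exact: openT.
by rewrite -ge0_fin_numE ?inner_content_ge0 ?inner_content_fin.
Qed.

Let outer0 : outer_content set0 = 0.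
Proof. by rewrite outer_content_open ?inner_content0//; exact: open0. Qed.

Let le_outer : {homo outer_content : A B / A `<=` B >-> A <= B}.
Proof.
move=> A B AB; apply: le_ereal_inf_tmp => _ [V [oV BV] <-].
by apply: ereal_inf_lbound; exists V => //; split => //; exact: subset_trans BV.
Qed.

Let outer_adherent A (e : R) : (0 < e)%R ->
  exists U, [/\ open U, A `<=` U & inner_content U <= outer_content A + e%:E].
Proof.
move=> e0; have [_ [U [oU AU] <-] /ltW ?] := lb_ereal_inf_adherent e0 (outer_fin A).
by exists U.
Qed.

Let outer_sigma_subadditive : sigma_subadditive outer_content.
Proof.
move=> A; apply/lee_addgt0Pr => e e0.
rewrite (le_trans _ (epsilon_trick _ _ (ltW e0)))//.
have /choice[U PU] : forall n, exists U, [/\ open U, A n `<=` U &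
    inner_content U <= outer_content (A n) + (e / (2 ^ n.+1)%:R)%:E].
  by move=> n; apply: outer_adherent; rewrite divr_gt0// ltr0n expn_gt0.
apply: (@le_trans _ _ (inner_content (\bigcup_n U n))).
  apply: ereal_inf_lbound; exists (\bigcup_n U n) => //; split.
    by apply: bigcup_open => n _; case: (PU n).
  by apply: subset_bigcup => n _; case: (PU n).
apply: le_trans (inner_content_bigcup _) _ => [n|]; first by case: (PU n).
by apply: lee_nneseries => n _; [move=> _; exact: inner_content_ge0|case: (PU n)].
Qed.

HB.instance Definition _ := isOuterMeasure.Build R T outer_content
  outer0 outer_ge0 le_outer outer_sigma_subadditive.

(** Take an open [W] around [A], a closed [K] nearly exhausting [W] in [U], and a closed [L] nearly
    exhausting [W] minus [K], each up to [e / 3]. As [K] and [L] are disjoint, their contents add up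
    within [W]. Removing [K] instead of [U] keeps the second set open while it still contains [A]
    minus [U]. *)
Lemma open_caratheodory U : open U -> outer_content.-caratheodory U.
Proof.
move=> oU; apply: le_caratheodory_measurable => A.
apply/lee_addgt0Pr => /= e e0.
have e3 : (0 < e / 3)%R by lra.
have [W [oW AW hW]] := outer_adherent A e3.
have [_ [K [cK KWU] <-] hK] :=
  ub_ereal_sup_adherent e3 (inner_content_fin (W `&` U)).
have oWK : open (W `&` ~` K) by apply: openI => //; exact: closed_openC.
have [_ [L [cL LWK] <-] hL] :=
  ub_ereal_sup_adherent e3 (inner_content_fin (W `&` ~` K)).
rewrite -/(inner_content (W `&` U)) in hK.
rewrite -/(inner_content (W `&` ~` K)) in hL.
have hU : outer_content (A `&` U) <= inner_content (W `&` U).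
  apply: ereal_inf_lbound; exists (W `&` U) => //.
  by split; [exact: openI|apply: setSI].
have hC : outer_content (A `&` ~` U) <= inner_content (W `&` ~` K).
  apply: ereal_inf_lbound; exists (W `&` ~` K) => //.
  split=> //; apply: setISS => //; apply: subsetC => x /KWU[]//.
have hKL : (lam K)%:E + (lam L)%:E <= inner_content W.
  rewrite -EFinD -lamU//; last by rewrite -subset0 => x [Kx /LWK[]].
  apply: inner_content_ub; first exact: closedU.
  by rewrite subUset; split=> x; [move/KWU|move/LWK] => -[].
move: hU hC hKL hW hK hL.
rewrite -(fineK (outer_fin A)) -(fineK (outer_fin (A `&` U))).
rewrite -(fineK (outer_fin (A `&` ~` U))) -(fineK (inner_content_fin W)).
rewrite -(fineK (inner_content_fin (W `&` U))).
rewrite -(fineK (inner_content_fin (W `&` ~` K))).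
rewrite -!EFinN -!EFinD !lee_fin !lte_fin => ? ? ? ? ? ?; lra.
Qed.

Let borel_caratheodory (A : set (borel T)) :
  measurable A -> outer_content.-caratheodory A.
Proof.
apply: smallest_sub; last exact: open_caratheodory.
split=> [|B|B].
- exact: caratheodory_measurable_set0.
- by rewrite setTD; exact: caratheodory_measurable_setC.
- exact: caratheodory_measurable_bigcup.
Qed.

Let outer_sigma_additive :
  semi_sigma_additive (outer_content : set (borel T) -> \bar R).
Proof.
move=> A mA tA mUA; apply: (@caratheodory_measure_sigma_additive R T) => //.
- by move=> i; exact: borel_caratheodory.
- exact: borel_caratheodory.
Qed.

(** By Caratheodory's theorem, since open sets, hence Borel sets, are measurable for the outer
    measure. Values are asserted on open sets only: on closed sets the measure may exceed [lam]. *)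
Theorem content_extension : lam setT = 1%R ->
  exists P : probability (borel T) R, forall U, open U -> P U = inner_content U.
Proof.
move=> lamT.
have PT : outer_content [set: T] = 1.
  rewrite outer_content_open; last exact: openT.
  apply/eqP; rewrite eq_le -[1]/(1%R%:E) -lamT inner_content_le/=.
  by apply: inner_content_ub => //; exact: closedT.
pose mu : set (borel T) -> \bar R := outer_content.
pose m := isMeasure.Build _ _ _ mu outer0 outer_ge0 outer_sigma_additive.
pose M : {measure set (borel T) -> \bar R} := HB.pack mu m.
pose p := Measure_isProbability.Build _ _ _ M PT.
pose P : probability (borel T) R := HB.pack mu m p.
by exists P => U oU; exact: outer_content_open.
Qed.

End content_outer_measure.

(** * Ultralimits of probabilities *)

Section filter_limits.
Context {R : realType} {I : Type}.

Lemma le_cvg_to (F : set_system I) (FF : ProperFilter F) (x y : I -> R) (a b : R) :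
  x i @[i --> F] --> a -> y i @[i --> F] --> b ->
  (\forall i \near F, x i <= y i) -> a <= b.
Proof.
move=> xa yb xy; rewrite -subr_ge0.
apply: (closed_cvg (fun z : R => 0 <= z)) (cvgB yb xa); first exact: closed_ge.
by near=> i; rewrite /= subr_ge0; near: i.
Unshelve. all: by end_near. Qed.

Lemma cvg_sumr (F : set_system I) (FF : Filter F) (K : Type) (s : seq K)
    (x : K -> I -> R) (a : K -> R) :
  (forall j, x j i @[i --> F] --> a j) ->
  \sum_(j <- s) x j i @[i --> F] --> \sum_(j <- s) a j.
Proof. by move=> xa; apply: cvg_big => //; exact: add_continuous. Qed.

(** The segment is compact, so there is a cluster point; an ultrafilter contains the preimage of
    each of its neighbourhoods or the complement, and the latter contradicts clustering. *)
Lemma ultra_is_cvg (F : set_system I) (UF : UltraFilter F) (x : I -> R) (M : R) :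
  (forall i, `|x i| <= M) -> cvg (x i @[i --> F]).
Proof.
move=> xM; have FF : ProperFilter F := ultra_proper.
have [|a [_ clxa]] := @segment_compact R (- M) M (x i @[i --> F]) _.
  by apply: nearW => i /=; rewrite in_itv/= -ler_norml.
apply/cvg_ex; exists a => B aB; have [//|/= nB] := in_ultra_setVsetC (x @^-1` B) UF.
by have [z [nBz /= Bz]] := clxa (~` B) B nB aB.
Qed.

End filter_limits.

(** * Continuous functions and Borel probabilities on a compact space *)

Section borel_continuous.
Context {R : realType} {T : ptopologicalType}.

Lemma borel_open (U : set T) : open U -> measurable (U : set (borel T)).
Proof. exact: sub_sigma_algebra. Qed.

Lemma borel_closed (K : set T) : closed K -> measurable (K : set (borel T)).
Proof. by move=> /closed_openC/borel_open/measurableC; rewrite setCK. Qed.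

Lemma continuous_borel_measurable (g : T -> R) :
  continuous g -> measurable_fun [set: borel T] (g : borel T -> R).
Proof.
move=> cg; apply: (measurability _ (RGenOInfty.measurableE R)).
move=> /= _ [_ [a ->]] <-; rewrite setTI; apply: borel_open.
by move/continuousP : cg; apply; exact: interval_open.
Qed.

Lemma continuous_measurable_self (t : T -> T) :
  continuous t -> measurable_fun [set: borel T] (t : borel T -> borel T).
Proof.
move=> ct; refine (@measurability _ _ (borel T) (borel T) setT t (@open T) erefl _).
move=> /= _ [U oU] <-; rewrite setTI; apply: borel_open.
by move/continuousP : ct; apply.
Qed.

(** Open sets form a generating family stable under intersection. *)
Lemma eq_probability_open (P Q : probability (borel T) R) :
  (forall U, open U -> P U = Q U) -> forall A, measurable A -> P A = Q A.
Proof.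
move=> PQ A mA; refine (@measure_unique _ _ (borel T) (@open T) (fun=> setT) erefl _ _ _ P Q PQ _ A mA).
- by move=> U V; exact: openI.
- by move=> _; exact: openT.
- by rewrite bigcup_const.
- by move=> _; apply: (le_lt_trans (probability_le1 P measurableT)); rewrite ltry.
Qed.

Hypothesis compactT : compact [set: T].

Lemma continuous_compact_bounded (g : T -> R) : continuous g ->
  exists M : R, forall x, `|g x| <= M.
Proof.
move=> cg; have cng : continuous (fun x => `|g x|).
  by move=> x; apply: (@cvg_norm _ _ _ _ _ g); exact: cg.
have [||c _ gc] := @compact_EVT_max T R (fun x => `|g x|) setT _ compactT.
- by exists point.
- exact: continuous_subspaceT.
- by exists `|g c| => x; apply: gc; exact/mem_set.
Qed.

Variable P : probability (borel T) R.

Lemma continuous_integrable (g : T -> R) :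
  continuous g -> P.-integrable [set: borel T] (EFin \o (g : borel T -> R)).
Proof.
move=> cg; have [M gM] := continuous_compact_bounded cg.
apply: measurable_bounded_integrable => //.
- by apply: (le_lt_trans (probability_le1 P measurableT)); rewrite ltry.
- exact: continuous_borel_measurable.
- by exists M; split; [exact: num_real|move=> N MN x _ /=; rewrite (le_trans (gM x)) ?ltW].
Qed.

Lemma pairing_Rintegral (g : T -> R) :
  continuous g -> pairing P g = (\int[P]_x g x)%:E.
Proof.
move=> cg; rewrite /pairing /Rintegral fineK//.
exact: integrable_fin_num (continuous_integrable cg).
Qed.

Lemma Rintegral_contD (g h : T -> R) : continuous g -> continuous h ->
  \int[P]_x (g x + h x) = \int[P]_x g x + \int[P]_x h x.
Proof. by move=> cg ch; apply: RintegralD => //; exact: continuous_integrable. Qed.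

Lemma Rintegral_contZ (a : R) (g : T -> R) : continuous g ->
  \int[P]_x (a * g x) = a * \int[P]_x g x.
Proof. by move=> cg; apply: RintegralZl => //; exact: continuous_integrable. Qed.

Lemma Rintegral_cont_sum (m : nat) (c : 'I_m -> R) (g : 'I_m -> T -> R) :
  (forall i, continuous (g i)) ->
  \int[P]_x (\sum_(i < m) c i * g i x) = \sum_(i < m) c i * \int[P]_x g i x.
Proof.
move=> cg; have int_cg i : P.-integrable [set: borel T] (EFin \o (fun x => c i * g i x)).
  by apply: continuous_integrable => x; apply: cvgMr; exact: cg.
rewrite /Rintegral; under eq_integral do rewrite -sumEFin.
rewrite integral_sum// -sum_fine; last by move=> i _; exact: integrable_fin_num (int_cg i).
by apply: eq_bigr => i _; exact: Rintegral_contZ.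
Qed.

Lemma Rintegral_prob_cst (a : R) : \int[P]_x a = a.
Proof. by rewrite Rintegral_cst//= (probability_setT P) mulr1. Qed.

Lemma le_Rintegral_cont (g h : T -> R) : continuous g -> continuous h ->
  (forall x, g x <= h x) -> \int[P]_x g x <= \int[P]_x h x.
Proof.
by move=> cg ch gh; apply: le_Rintegral => //; exact: continuous_integrable.
Qed.

Lemma Rintegral_cont_dist (g h : T -> R) (e : R) : continuous g -> continuous h ->
  (forall x, `|g x - h x| <= e) -> `|\int[P]_x g x - \int[P]_x h x| <= e.
Proof.
move=> cg ch gh; have ce : continuous (fun=> e : R) := @cst_continuous T R e.
rewrite ler_distlC; apply/andP; split.
- rewrite lerBlDr -[X in _ <= _ + X]Rintegral_prob_cst -Rintegral_contD//.
  apply: le_Rintegral_cont => // [x|x]; first by apply: cvgD; [exact: ch|exact: ce].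
  by have := gh x; rewrite ler_norml; lra.
- rewrite -[X in _ <= _ + X]Rintegral_prob_cst -Rintegral_contD//.
  apply: le_Rintegral_cont => // [x|x]; first by apply: cvgD; [exact: cg|exact: ce].
  by have := gh x; rewrite ler_norml; lra.
Qed.

End borel_continuous.

(** * Layer-cake comparison of integrals with measures of closed level sets *)

Lemma sum_le_steps (R : realType) (N : nat) (y : R) : 0 <= y ->
  \sum_(j < N) (j.+1%:R <= y)%R%:R <= y.
Proof.
(* The sum counts the integers from 1 to [N] not exceeding [y]. The bound by [N] joins the induction
   to absorb a new unit term when [N.+1 <= y]. *)
move=> y0; suff : \sum_(j < N) (j.+1%:R <= y)%R%:R <= y /\
    \sum_(j < N) (j.+1%:R <= y)%R%:R <= N%:R :> R by case.
elim: N => [|N [ih1 ih2]]; first by rewrite big_ord0.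
rewrite big_ord_recr/=; have [Ny|Ny] := leP N.+1%:R y.
  by move: Ny; rewrite /= mulr1n -natr1; split; lra.
by rewrite /= mulr0n addr0 -natr1; split => //; lra.
Qed.

Lemma sum_ge_steps (R : realType) (N : nat) (y : R) : y <= N%:R ->
  y <= \sum_(j < N) (j.+1%:R <= y)%R%:R + 1.
Proof.
(* The exact count is carried along for the case where [y] lies between [N] and [N + 1]. *)
move=> yN; suff [_ h2] : (N%:R <= y -> \sum_(j < N) (j.+1%:R <= y)%R%:R = N%:R :> R) /\
    (y <= N%:R -> y <= \sum_(j < N) (j.+1%:R <= y)%R%:R + 1) by exact: h2.
elim: N {yN} => [|N [ih1 ih2]]; first by rewrite big_ord0; split=> //; lra.
rewrite big_ord_recr/= -natr1; have [Ny|Ny] := leP (N%:R + 1) y.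
  by rewrite /= mulr1n ih1; [split => //; lra|lra].
rewrite /= mulr0n addr0; split=> [|_]; first lra.
by have [yN|/ltW Ny'] := leP y N%:R; [exact: ih2|rewrite ih1//; lra].
Qed.

Section layer_cake.
Context {R : realType} {T : ptopologicalType}.
Hypothesis compactT : compact [set: T].
Context (g : T -> R) (N : nat).
Hypothesis cg : continuous g.
Hypothesis g01 : forall x, 0 <= g x <= 1.

(** The superlevel set of [g] at height [(j + 1) / N], written without division. Summing the first
    [N] indicators recovers [N * g] up to an error of 1. *)
Definition level (j : nat) : set T := [set x | j.+1%:R <= N%:R * g x].

Lemma closed_level j : closed (level j).
Proof.
have cNg : continuous (fun x => N%:R * g x) by move=> x; apply: cvgMr; exact: cg.
by move/continuous_closedP : cNg => /(_ [set y | j.+1%:R <= y]); apply; exact: closed_ge.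
Qed.

Variable P : probability (borel T) R.

Lemma Rintegral_sum_level :
  \int[P]_x (\sum_(j < N) \1_(level j) x) = \sum_(j < N) fine (P (level j)).
Proof.
have mL j : measurable (level j : set (borel T)) by apply: borel_closed; exact: closed_level.
rewrite /Rintegral; under eq_integral do rewrite -sumEFin.
rewrite integral_sum//; last by move=> j; exact: integrable_indic.
under eq_bigr do rewrite integral_indic// setIT.
by rewrite sum_fine// => j _; exact: fin_num_measure.
Qed.

Let sum_level x :
  \sum_(j < N) \1_(level j) x = \sum_(j < N) (j.+1%:R <= N%:R * g x)%R%:R :> R.
Proof.
apply: eq_bigr => j _; rewrite indicE; congr (_%:R); congr nat_of_bool.
by apply/idP/idP => [/set_mem//|h]; exact/mem_set.
Qed.

Let int_sum : P.-integrable [set: borel T]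
  (EFin \o (fun x => \sum_(j < N) \1_(level j) x : R)).
Proof.
rewrite (_ : _ \o _ = fun x => (\sum_(j < N) (\1_(level j) x)%:E)%E).
  apply: integrable_sum => // j _; apply: integrable_indic.
  by apply: borel_closed; exact: closed_level.
by apply/funext => x /=; rewrite -sumEFin.
Qed.

Let cNg : continuous (fun x => N%:R * g x).
Proof. by move=> x; apply: cvgMr; exact: cg. Qed.

Lemma layer_cake_le : \sum_(j < N) fine (P (level j)) <= N%:R * \int[P]_x g x.
Proof.
rewrite -Rintegral_contZ// -Rintegral_sum_level.
apply: le_Rintegral => //; first exact: continuous_integrable.
move=> x _; rewrite sum_level; apply: sum_le_steps.
by have /andP[g0 _] := g01 x; rewrite mulr_ge0.
Qed.

Lemma layer_cake_ge : N%:R * \int[P]_x g x <= \sum_(j < N) fine (P (level j)) + 1.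
Proof.
have int1 : P.-integrable [set: borel T] (EFin \o (fun=> 1 : R)).
  by apply: continuous_integrable => //; exact: cst_continuous.
rewrite -Rintegral_contZ// -Rintegral_sum_level -[X in _ <= _ + X](Rintegral_prob_cst P).
rewrite -RintegralD//; apply: le_Rintegral => //.
- exact: continuous_integrable.
- exact: (integrableD measurableT int_sum int1).
- move=> x _; rewrite sum_level; apply: sum_ge_steps.
  by have /andP[_ g1] := g01 x; rewrite ler_piMr.
Qed.

End layer_cake.

(** * Weak-* limits of probabilities along an ultrafilter *)

Section ultralimit.
Context {R : realType} {T : ptopologicalType} {I : Type} {F : set_system I}.
Context (UF : UltraFilter F) (mu_ : I -> probability (borel T) R).
Hypothesis hausdorffT : hausdorff_space T.
Hypothesis compactT : compact [set: T].

Let FF : ProperFilter F := ultra_proper.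

(** A genuine limit on measurable sets, where the values stay in [[0, 1]]. *)
Definition ultralim_content (K : set T) : R := lim (fine (mu_ i K) @[i --> F]).

Let cvg_content K : measurable (K : set (borel T)) ->
  fine (mu_ i K) @[i --> F] --> ultralim_content K.
Proof.
move=> mK; apply: (ultra_is_cvg UF (M := 1)) => i.
rewrite ger0_norm ?fine_ge0// -lee_fin fineK ?fin_num_measure//.
exact: probability_le1.
Qed.

Let fine_muU i (K L : set (borel T)) : measurable K -> measurable L ->
  fine (mu_ i (K `|` L)) <= fine (mu_ i K) + fine (mu_ i L).
Proof.
move=> mK mL; rewrite -fineD ?fin_num_measure//.
rewrite fine_le ?fin_numD ?fin_num_measure//; first exact: measurableU.
exact: measureU2.
Qed.

Lemma ultralim_content_extension : exists P : probability (borel T) R,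
  forall U, open U -> P U = inner_content ultralim_content U.
Proof.
apply: content_extension => //; first exact: compact_normal.
- move=> K L /borel_closed mK /borel_closed mL KL.
  apply: (le_cvg_to FF (cvg_content mK) (cvg_content mL)); apply: nearW => i.
  by rewrite fine_le ?fin_num_measure//; apply: le_measure => //; exact/mem_set.
- move=> K L /borel_closed mK /borel_closed mL.
  have mKL := measurableU _ _ mK mL.
  apply: (le_cvg_to FF (cvg_content mKL) (cvgD (cvg_content mK) (cvg_content mL))).
  by apply: nearW => i; exact: fine_muU.
- move=> K L /borel_closed mK /borel_closed mL KL.
  have mKL := measurableU _ _ mK mL.
  apply: (cvg_unique _ (cvg_content mKL)); first exact: Rhausdorff.
  rewrite (_ : (fun i => _) = fun i => fine (mu_ i K) + fine (mu_ i L)).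
    exact: cvgD (cvg_content mK) (cvg_content mL).
  by apply/funext => i; rewrite measureU// fineD ?fin_num_measure.
- apply: (cvg_unique _ (cvg_content measurableT)); first exact: Rhausdorff.
  rewrite (_ : (fun i => _) = fun=> 1); first exact: cvg_cst.
  by apply/funext => i; rewrite (probability_setT (mu_ i)).
Qed.

Section ultralimit_probability.
Variable P : probability (borel T) R.
Hypothesis PE : forall U, open U -> P U = inner_content ultralim_content U.

(** A closed [L] disjoint from [K] has content at most [1 - ultralim_content K]; taking the supremum
    over [L] bounds the measure of the complement of [K]. *)
Lemma ultralim_content_le K : closed K -> ultralim_content K <= fine (P K).
Proof.
move=> cK; have mK := borel_closed cK.
have : (P (~` K) <= (1 - ultralim_content K)%:E)%E.
  rewrite PE; last exact: closed_openC.
  apply: ge_ereal_sup => _ [L [cL LK] <-]; have mL := borel_closed cL.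
  rewrite lee_fin lerBrDr.
  have c1 : (fun=> 1 : R) i @[i --> F] --> (1 : R) by exact: cvg_cst.
  apply: (le_cvg_to FF (cvgD (cvg_content mL) (cvg_content mK)) c1).
  apply: nearW => i; rewrite /= -fineD ?fin_num_measure// -measureU//; last first.
    by rewrite -subset0 => x [/LK].
  rewrite -lee_fin fineK ?fin_num_measure//; last exact: measurableU.
  by apply: probability_le1; exact: measurableU.
rewrite probability_setC// -[P K]fineK ?fin_num_measure// -[1%E]/(1%:E).
by rewrite -EFinB lee_fin; lra.
Qed.

(** The upper layer-cake bound for [mu_ i], the comparison on closed level sets and the lower bound
    for [P] combine into [N * l <= N * \int[P]_x g x + 1] for every [N]. *)
Let Rintegral01_le (g : T -> R) (l : R) : continuous g -> (forall x, 0 <= g x <= 1) ->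
  \int[mu_ i]_x g x @[i --> F] --> l -> l <= \int[P]_x g x.
Proof.
move=> cg g01 gl; have mL N j := borel_closed (@closed_level R T g N cg j).
have cvgS N n : \sum_(j < n) fine (mu_ i (level g N j)) @[i --> F] -->
    \sum_(j < n) ultralim_content (level g N j).
  by apply: cvg_sumr => j; exact: cvg_content (mL N j).
have N_le N : N%:R * l <= N%:R * \int[P]_x g x + 1.
  apply: (@le_trans _ _ (\sum_(j < N) ultralim_content (level g N j) + 1)).
    have c1 : (fun=> 1 : R) i @[i --> F] --> (1 : R) by exact: cvg_cst.
    have cN : N%:R * \int[mu_ i]_x g x @[i --> F] --> N%:R * l by exact: cvgMr.
    apply: (le_cvg_to FF cN (cvgD (cvgS N N) c1)).
    by apply: nearW => i; exact: layer_cake_ge.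
  rewrite lerD2r; apply: le_trans (layer_cake_le compactT _ cg g01 P).
  by apply: ler_sum => j _; apply: ultralim_content_le; exact: closed_level.
(* Otherwise an [N] larger than the inverse of the gap violates [N_le]. *)
rewrite leNgt; apply/negP => lt; have d0 : 0 < l - \int[P]_x g x by rewrite subr_gt0.
have := N_le (truncn (l - \int[P]_x g x)^-1).+1.
have := truncnS_gt (l - \int[P]_x g x)^-1.
by rewrite -(ltr_pM2r d0) mulVf ?gt_eqF// mulrBr; lra.
Qed.

Let Rintegral_le (g : T -> R) (l : R) : continuous g ->
  \int[mu_ i]_x g x @[i --> F] --> l -> l <= \int[P]_x g x.
Proof.
(* An affine change of [g] into [[0, 1]] reduces to the previous case; the added 1 keeps [A]
   positive when [M] is 0. *)
move=> cg gl; have [M gM] := continuous_compact_bounded compactT cg.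
pose A := M + 1; have A0 : 0 < A.
  by rewrite ltr_wpDl// (le_trans _ (gM point)).
pose g' x := (2 * A)^-1 * (g x + A).
have cA : continuous (fun _ : T => A) by exact: cst_continuous.
have cgA : continuous (fun x => g x + A).
  by move=> x; apply: cvgD; [exact: cg|exact: cA].
have cg' : continuous g' by move=> x; apply: cvgMr; exact: cgA.
have g'E (Q : probability (borel T) R) :
    \int[Q]_x g' x = (2 * A)^-1 * (\int[Q]_x g x + A).
  by rewrite Rintegral_contZ// Rintegral_contD// Rintegral_prob_cst.
have : (2 * A)^-1 * (l + A) <= \int[P]_x g' x.
  apply: Rintegral01_le => // [x|].
    have := gM x; rewrite ler_norml /g' => /andP[? ?].
    rewrite mulr_ge0 ?invr_ge0/=; [|by rewrite /A in A0 *; lra|by rewrite /A; lra].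
    by rewrite mulrC ler_pdivrMr /A; [lra|rewrite /A in A0; lra].
  under eq_fun do rewrite g'E.
  by apply: cvgMr; apply: cvgD => //; exact: cvg_cst.
by rewrite g'E ler_pM2l ?invr_gt0 ?mulr_gt0// lerD2r.
Qed.

Lemma ultralim_Rintegral (g : T -> R) : continuous g ->
  \int[mu_ i]_x g x @[i --> F] --> \int[P]_x g x.
Proof.
move=> cg; have [M gM] := continuous_compact_bounded compactT cg.
have /cvg_ex[l /= gl] : cvg (\int[mu_ i]_x g x @[i --> F]).
  apply: (ultra_is_cvg UF (M := M)) => i; rewrite -[X in `|X|]subr0.
  rewrite -[X in _ - X](Rintegral_prob_cst (mu_ i)).
  apply: Rintegral_cont_dist => // [|x]; first exact: cst_continuous.
  by rewrite subr0.
(* One-sided comparison for [g] and for its negative gives equality. *)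
suff -> : \int[P]_x g x = l by [].
apply/eqP; rewrite eq_le (Rintegral_le cg gl) andbT -lerN2.
have cNg : continuous (fun x => -1 * g x) by move=> x; apply: cvgMr; exact: cg.
have gNl : \int[mu_ i]_x (-1 * g x) @[i --> F] --> -1 * l.
  rewrite (_ : (fun i => _) = fun i => -1 * \int[mu_ i]_x g x); first exact: cvgMr.
  by apply/funext => i; exact: Rintegral_contZ.
by have := Rintegral_le cNg gNl; rewrite Rintegral_contZ// !mulN1r.
Qed.

Lemma ultralim_invariant (t : T -> T) : continuous t ->
  (forall i (A : set (borel T)), measurable A -> mu_ i (t @^-1` A) = mu_ i A) ->
  forall A : set (borel T), measurable A -> P (t @^-1` A) = P A.
Proof.
move=> ct inv A mA; have mt := continuous_measurable_self ct.
have lamE K : closed K -> ultralim_content (t @^-1` K) = ultralim_content K.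
  move=> cK; rewrite /ultralim_content.
  under eq_fun do rewrite (inv _ _ (borel_closed cK)).
  by [].
have preK K : closed K -> closed (t @^-1` K).
  by move=> cK; move/continuous_closedP : ct; exact.
pose X : {mfun borel T >-> borel T} := mfun_Sub (mem_set mt).
(* The left side is the push-forward of [P], again a probability, so open sets suffice. *)
rewrite -[LHS]/(distribution P X A).
apply: eq_probability_open mA => U oU.
have otU : open (t @^-1` U) by move/continuousP : ct; exact.
rewrite -[LHS]/(P (t @^-1` U)) !PE//.
apply/eqP; rewrite eq_le; apply/andP; split; apply: ge_ereal_sup => _ [K [cK KU] <-].
(* A closed [K] in the preimage of [U] has a closed image inside [U]. Since [K] lies in the preimage
   of that image, invariance bounds its content by that of the image. *)
- have ctK : closed (t @` K).
    apply: compact_closed => //; apply: continuous_compact.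
      exact: continuous_subspaceT.
    exact: subclosed_compact compactT _.
  apply: (@le_trans _ _ (ultralim_content (t @` K))%:E).
    rewrite -(lamE _ ctK) lee_fin.
    have mK := borel_closed cK; have mtK := borel_closed (preK _ ctK).
    apply: (le_cvg_to FF (cvg_content mK) (cvg_content mtK)); apply: nearW => i.
    rewrite fine_le ?fin_num_measure//; apply: le_measure; [exact/mem_set..|].
    exact: preimage_image.
  apply: ereal_sup_ubound; exists (t @` K) => //; split=> //.
  by move=> _ [x Kx <-]; exact: KU.
- rewrite -(lamE _ cK); apply: ereal_sup_ubound; exists (t @^-1` K) => //.
  by split; [exact: preK|move=> x /KU].
Qed.

End ultralimit_probability.

Theorem ultralimit_probability : exists P : probability (borel T) R,
  (forall g : T -> R, continuous g -> \int[mu_ i]_x g x @[i --> F] --> \int[P]_x g x) /\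
  (forall t : T -> T, continuous t ->
    (forall i (A : set (borel T)), measurable A -> mu_ i (t @^-1` A) = mu_ i A) ->
    forall A : set (borel T), measurable A -> P (t @^-1` A) = P A).
Proof.
have [P PE] := ultralim_content_extension.
by exists P; split; [exact: ultralim_Rintegral|exact: ultralim_invariant].
Qed.

End ultralimit.

(** * Equilibrium states *)

Section equilibrium.
Context {R : realType} {T : ptopologicalType} {k : acting_monoid} {l : nat}.
Context (tau : lat k l -> T -> T) (f : T -> R) (V : set (T -> R)).
Hypothesis hausdorffT : hausdorff_space T.
Hypothesis compactT : compact [set: T].
Hypothesis continuous_tau : forall a, continuous (tau a).
Hypothesis entropy_fin : forall mu : probability (borel T) R,
  tau_invariant tau mu -> ms_entropy tau mu \is a fin_num.
Hypothesis usc : entropy_usc R tau.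
Hypothesis cf : continuous f.
Hypothesis VD : forall g h, V g -> V h -> V (fun x => g x + h x).
Hypothesis VZ : forall (a : R) g, V g -> V (fun x => a * g x).
Hypothesis V0 : V (fun=> 0).
Hypothesis cV : forall g, V g -> continuous g.

Local Notation prob := (probability (borel T) R).

(** Faithful on invariant measures, where the entropy is finite. *)
Definition rentropy (mu : prob) : R := fine (ms_entropy tau mu).

Lemma rentropyE mu : tau_invariant tau mu -> ms_entropy tau mu = (rentropy mu)%:E.
Proof. by move=> imu; rewrite /rentropy fineK ?entropy_fin. Qed.

Lemma equilibrium_stateP (g : T -> R) (mu : prob) : continuous g -> tau_invariant tau mu ->
  equilibrium_state tau g mu <-> (forall nu : prob, tau_invariant tau nu ->
    \int[nu]_x g x + rentropy nu <= \int[mu]_x g x + rentropy mu).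
Proof.
move=> cg imu.
have E (nu : prob) : tau_invariant tau nu ->
    (pairing nu g + ms_entropy tau nu)%E = (\int[nu]_x g x + rentropy nu)%:E.
  by move=> inu; rewrite pairing_Rintegral// rentropyE.
split=> [[_ emu] nu inu|mumax].
  rewrite -lee_fin -!E// emu; apply: ereal_sup_ubound.
  by exists nu.
split=> //; apply/eqP; rewrite eq_le; apply/andP; split.
  by apply: ereal_sup_ubound; exists mu.
by apply: ge_ereal_sup => _ [nu inu <-]; rewrite !E// lee_fin mumax.
Qed.

(** Upper semi-continuity along an arbitrary proper filter, so that it serves both ultrafilters and
    sequences. *)
Lemma rentropy_near_lt (I : Type) (F : set_system I) (FF : ProperFilter F)
    (mu_ : I -> prob) (mu : prob) (c : R) :
  (forall i, tau_invariant tau (mu_ i)) -> tau_invariant tau mu ->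
  (forall g : T -> R, continuous g ->
    \int[mu_ i]_x g x @[i --> F] --> \int[mu]_x g x) ->
  rentropy mu < c -> \forall i \near F, rentropy (mu_ i) < c.
Proof.
move=> imu_ imu mu_mu muc.
have [|m [gs [e [e0 cgs nbhd]]]] := usc imu (c := c).
  by rewrite rentropyE// lte_fin.
have : \forall i \near F, forall j : 'I_m,
    `|\int[mu]_x gs j x - \int[mu_ i]_x gs j x| < e.
  by apply: filter_forall => j; have /cvgrPdist_lt := mu_mu _ (cgs j); exact.
apply: filterS => i h; rewrite -lte_fin -rentropyE//; apply: nbhd => // j.
by rewrite !pairing_Rintegral// -EFinB lte_fin distrC.
Qed.

Hypothesis uniq : forall g, V g -> unique_equilibrium_state tau (fun x => f x + g x).

Let cfV g : V g -> continuous (fun x => f x + g x).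
Proof. by move=> Vg x; apply: cvgD; [exact: cf|exact: cV]. Qed.

(** Membership in [V] is placed under the existential so that choice yields a total function [st];
    outside [V] its value is arbitrary. Uniqueness is restated through integrals. *)
Let has_state g : exists mu : prob, V g ->
  [/\ tau_invariant tau mu, equilibrium_state tau (fun x => f x + g x) mu &
      forall nu : prob, equilibrium_state tau (fun x => f x + g x) nu ->
        forall h, \int[nu]_x h x = \int[mu]_x h x].
Proof.
have [Vg|nVg] := pselect (V g); last by have [mu _] := uniq V0; exists mu.
have [mu [emu umu]] := uniq Vg; exists mu => _; split=> //; first by case: emu.
move=> nu enu h; congr fine; apply: eq_measure_integral => A mA _.
exact: umu.
Qed.

Let st g : prob := projT1 (cid (has_state g)).

Let st_inv g : V g -> tau_invariant tau (st g).
Proof. by move=> Vg; have [] := projT2 (cid (has_state g)) Vg. Qed.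

Let st_eq g : V g -> equilibrium_state tau (fun x => f x + g x) (st g).
Proof. by move=> Vg; have [] := projT2 (cid (has_state g)) Vg. Qed.

Let st_uniq g (nu : prob) : V g -> equilibrium_state tau (fun x => f x + g x) nu ->
  forall h, \int[nu]_x h x = \int[st g]_x h x.
Proof. by move=> Vg; have [_ _ +] := projT2 (cid (has_state g)) Vg; apply. Qed.

(** For [g] in [V], the real value of the pressure at [f + g], read off the state attaining it. *)
Let rpressure g := \int[st g]_x (f x + g x) + rentropy (st g).

Let le_rpressure g (nu : prob) : V g -> tau_invariant tau nu ->
  \int[nu]_x f x + \int[nu]_x g x + rentropy nu <= rpressure g.
Proof.
move=> Vg inu; rewrite -Rintegral_contD//; last exact: cV.
exact: (equilibrium_stateP (cfV Vg) (st_inv Vg)).1 (st_eq Vg) nu inu.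
Qed.

Let rpressureE g : V g -> rpressure g =
  \int[st g]_x f x + \int[st g]_x g x + rentropy (st g).
Proof. by move=> Vg; rewrite /rpressure Rintegral_contD//; exact: cV. Qed.

(* Equilibrium states of [f + v + t w] cluster, as [t] goes to [0], at an
   equilibrium state of [f + v], so uniqueness makes the pressure differentiable
   at [v] in the direction [w]. *)
Let tangent v w (a b : R) : V v -> V w ->
  (forall t, 0 < t -> rpressure v + a * t - b * t ^+ 2 <=
                      rpressure (fun x => v x + t * w x)) ->
  a <= \int[st v]_x w x.
Proof.
move=> Vv Vw grow.
pose t (n : nat) : R := n.+1%:R^-1.
have t0 n : 0 < t n by rewrite invr_gt0.
pose vw n x := v x + t n * w x.
have Vvw n : V (vw n) by apply: VD => //; exact: VZ.
(* Along an ultrafilter finer than the eventual filter, the states have a weak-* limit and [t n]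
   still tends to 0. *)
have [F [UF ooF]] := ultraFilterLemma eventually_filter.
have FF : ProperFilter F := @ultra_proper _ _ UF.
have ct : t n @[n --> F] --> 0.
  by move=> A A0; apply: ooF; exact: (@cvg_harmonic R).
have [nu [nuE nuI]] := ultralimit_probability UF (fun n => st (vw n)) hausdorffT compactT.
have inu : tau_invariant tau nu.
  by move=> s A mA; apply: nuI => // n B mB; exact: st_inv.
have vwE (eta : prob) n : \int[eta]_x vw n x = \int[eta]_x v x + t n * \int[eta]_x w x.
  rewrite Rintegral_contD ?Rintegral_contZ//; [exact: cV..|].
  by apply: cV; exact: VZ.
have enu : equilibrium_state tau (fun x => f x + v x) nu.
  apply: (equilibrium_stateP (cfV Vv) inu).2.
  move=> eta ieta; rewrite !Rintegral_contD//; [|exact: cV..].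
  (* The variational inequality for [st (vw n)] against [eta] passes to the limit; semi-continuity
     replaces its entropy by that of [nu] at the cost of [e]. *)
  apply/ler_addgt0Pr => e e0.
  have ent_e : rentropy nu < rentropy nu + e by rewrite ltrDl.
  have near_ent := rentropy_near_lt FF (fun n => st_inv (Vvw n)) inu nuE ent_e.
  have lhs : \int[eta]_x f x + (\int[eta]_x v x + t n * \int[eta]_x w x) + rentropy eta
      @[n --> F] --> \int[eta]_x f x + (\int[eta]_x v x + 0 * \int[eta]_x w x) + rentropy eta.
    apply: cvgD; last exact: cvg_cst.
    apply: cvgD; first exact: cvg_cst.
    by apply: cvgD; [exact: cvg_cst|apply: cvgMl].
  have rhs : \int[st (vw n)]_x f x +
      (\int[st (vw n)]_x v x + t n * \int[st (vw n)]_x w x) + (rentropy nu + e)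
      @[n --> F] --> \int[nu]_x f x + (\int[nu]_x v x + 0 * \int[nu]_x w x) + (rentropy nu + e).
    apply: cvgD; last exact: cvg_cst.
    apply: cvgD; first exact: nuE.
    by apply: cvgD; [apply: nuE; exact: cV|apply: cvgM => //; apply: nuE; exact: cV].
  have := le_cvg_to FF lhs rhs; rewrite !mul0r !addr0 -!addrA; apply.
  apply: filterS near_ent => n ent_n.
  have := le_rpressure (Vvw n) ieta; rewrite rpressureE// !vwE; lra.
rewrite -(st_uniq Vv enu).
have lhs : a - b * t n @[n --> F] --> a - b * 0.
  by apply: cvgB; [exact: cvg_cst|exact: cvgMr].
have := le_cvg_to FF lhs (nuE w (cV Vw)); rewrite mulr0 subr0; apply.
(* Testing [st (vw n)] in the variational principle at [v] and using [grow] leaves an inequality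
   with a factor [t n], which is divided out. *)
apply: nearW => n.
have := grow _ (t0 n); have := le_rpressure Vv (st_inv (Vvw n)).
rewrite -/(vw n) (rpressureE (Vvw n)) vwE => h1 h2.
by rewrite -(ler_pM2l (t0 n)); move: h1 h2; rewrite expr2; nra.
Qed.

(** * Minimization of the penalized pressure over finitely many directions *)

Section quadratic_minimization.
Context (m : nat) (g : 'I_m -> T -> R) (mu : prob).
Hypothesis Vg : forall i, V (g i).
Hypothesis imu : tau_invariant tau mu.

Let comb (c : 'rV[R]_m) : T -> R := fun x => \sum_(i < m) c ord0 i * g i x.

Let Vcomb c : V (comb c).
Proof.
have : forall s : seq 'I_m, V (fun x => \sum_(i <- s) c ord0 i * g i x).
  elim=> [|i s ih].
    by rewrite (_ : (fun x => _) = fun=> 0)//; apply/funext => x; rewrite big_nil.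
  rewrite (_ : (fun x => _) =
    fun x => c ord0 i * g i x + \sum_(i <- s) c ord0 i * g i x).
    by apply: VD => //; exact: VZ.
  by apply/funext => x; rewrite big_cons.
exact.
Qed.

Let cg i : continuous (g i). Proof. exact: cV. Qed.

Let Rintegral_comb (nu : prob) c :
  \int[nu]_x comb c x = \sum_(i < m) c ord0 i * \int[nu]_x g i x.
Proof. exact: Rintegral_cont_sum. Qed.

(** Testing the state at [c] in the variational principle at [d] gives a Lipschitz bound with the
    sup norms of the [g i] as constants. *)
Let continuous_rpressure_comb : continuous (fun c => rpressure (comb c)).
Proof.
have /choice[M gM] := fun i => continuous_compact_bounded compactT (@cg i).
have lip c d : rpressure (comb c) - rpressure (comb d) <=
    \sum_(i < m) `|c ord0 i - d ord0 i| * M i.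
  have := le_rpressure (Vcomb d) (st_inv (Vcomb c)).
  rewrite (rpressureE (Vcomb c)) !Rintegral_comb => h.
  apply: (@le_trans _ _ (\sum_(i < m) (c ord0 i * \int[st (comb c)]_x g i x -
      d ord0 i * \int[st (comb c)]_x g i x))); first by rewrite sumrB; lra.
  apply: ler_sum => i _; rewrite -mulrBl (le_trans (ler_norm _))// normrM.
  apply: ler_wpM2l => //; rewrite -[X in `|X|]subr0.
  rewrite -[X in _ - X](Rintegral_prob_cst (st (comb c))).
  apply: Rintegral_cont_dist => // [|x]; first exact: cst_continuous.
  by rewrite subr0.
move=> c; apply: (cvgrPdist_lt (F := nbhs c) _ _).2 => e e0.
have D0 : \sum_(i < m) `|c ord0 i - d ord0 i| * M i @[d --> c] -->
    \sum_(i < m) `|c ord0 i - c ord0 i| * M i.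
  apply: (@cvg_sumr R 'rV[R]_m (nbhs c) _ _ _
    (fun i (d : 'rV[R]_m) => `|c ord0 i - d ord0 i| * M i)) => i.
  apply: cvgMl; apply: (cvg_norm (F := nbhs c)); apply: (cvgB (F := nbhs c)).
    exact: cvg_cst.
  exact: coord_continuous.
apply: filterS ((@cvgrPdist_lt R R _ (nbhs c) _ _ _).1 D0 e e0) => d.
rewrite [X in `|X - _|]big1; last by move=> i _; rewrite subrr normr0 mul0r.
rewrite sub0r normrN.
move=> /(le_lt_trans (ler_norm _)) lt_e; apply: le_lt_trans lt_e.
rewrite ler_norml lip lerNl opprB.
by under eq_bigr do rewrite distrC; rewrite lip.
Qed.

Variable lm : R.
Hypothesis lm0 : 0 < lm.

Let J (c : 'rV[R]_m) := rpressure (comb c) - \sum_(i < m) c ord0 i * \int[mu]_x g i x +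
  (\sum_(i < m) c ord0 i ^+ 2) / (2 * lm).

(** Testing [mu] in the variational principle cancels the linear term; the quadratic term that
    remains makes [J] coercive. *)
Let J_ge (c : 'rV[R]_m) :
  \int[mu]_x f x + rentropy mu + (\sum_(i < m) c ord0 i ^+ 2) / (2 * lm) <= J c.
Proof. by have := le_rpressure (Vcomb c) imu; rewrite Rintegral_comb /J; lra. Qed.

Let continuous_J : continuous J.
Proof.
move=> c; apply: (cvgD (F := nbhs c)).
  apply: (cvgB (F := nbhs c)); first exact: continuous_rpressure_comb.
  apply: (@cvg_sumr R 'rV[R]_m (nbhs c) _ _ _
    (fun i (d : 'rV[R]_m) => d ord0 i * \int[mu]_x g i x)) => i.
  by apply: cvgMl; exact: coord_continuous.
apply: (cvgMl (F := nbhs c)); apply: (@cvg_sumr R 'rV[R]_m (nbhs c) _ _ _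
  (fun i (d : 'rV[R]_m) => d ord0 i ^+ 2)) => i.
by rewrite expr2; apply: (cvgM (F := nbhs c)); exact: coord_continuous.
Qed.

Let J_min : exists c, forall d, J c <= J d.
Proof.
(* Outside the box of half-width [M], some squared coordinate is at least [M - 1], so [J_ge] gives a
   value at least [J 0]. The added 1 ensures [1 <= M], whence [M] is at most its square. *)
pose M := 2 * lm * (J 0 - (\int[mu]_x f x + rentropy mu)) + 1.
have sum0 : \sum_(i < m) (0 : 'rV[R]_m) ord0 i ^+ 2 = 0.
  by rewrite big1// => i _; rewrite mxE expr0n.
have M1 : 1 <= M.
  rewrite lerDr mulr_ge0//; first by rewrite mulr_ge0// ltW.
  by rewrite subr_ge0; have := J_ge 0; rewrite sum0 mul0r addr0.
pose box := [set c : 'rV[R]_m | forall i, c ord0 i \in `[- M, M]].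
have box0 : box 0 by move=> i; rewrite mxE in_itv/=; lra.
have [||c cB cmin] := @EVT_min_rV R m J box (ex_intro _ _ box0).
- exact: (@rV_compact R m (fun=> `[- M, M]%classic) (fun=> @segment_compact R (- M) M)).
- exact: continuous_subspaceT.
exists c => d; have [dB|] := pselect (box d); first by apply: cmin; exact/mem_set.
move=> /existsNP[i]; rewrite in_itv/= -ler_norml => /negP; rewrite -ltNge => Md.
apply: le_trans (cmin 0 (mem_set box0)) _.
apply: le_trans (J_ge d); rewrite -lerBlDl ler_pdivlMr ?mulr_gt0//.
apply: (@le_trans _ _ (d ord0 i ^+ 2)).
  rewrite -[d ord0 i ^+ 2]real_normK ?num_real//.
  have -> : (J 0 - (\int[mu]_x f x + rentropy mu)) * (2 * lm) = M - 1 by rewrite /M; ring.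
  have aux (y z : R) : 1 <= y -> y < z -> y - 1 <= z ^+ 2 by nra.
  exact: aux.
by rewrite (bigD1 i)//= lerDl sumr_ge0// => j _; exact: sqr_ge0.
Qed.

Lemma quadratic_minimizer : exists c : 'rV[R]_m,
  [/\ V (comb c),
      \int[mu]_x f x + rentropy mu + (\sum_(i < m) c ord0 i ^+ 2) / (2 * lm) <=
        rpressure (fun=> 0) &
      forall i, \int[st (comb c)]_x g i x = \int[mu]_x g i x - c ord0 i / lm].
Proof.
have [c cmin] := J_min; exists c; split=> //.
  apply: (le_trans (J_ge c)); apply: (le_trans (cmin 0)).
  rewrite /J (_ : comb 0 = fun=> 0); last first.
    by apply/funext => x; rewrite /comb big1// => i _; rewrite mxE mul0r.
  by rewrite !big1 ?mul0r ?subr0 ?addr0// => i _; rewrite mxE ?expr0n ?mul0r.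
move=> i.
(* Minimality of [J] at [c] against [c] shifted by [t] in coordinate [i]; it holds for both signs of
   [t]. *)
have step (t : R) : rpressure (comb c) +
    (\int[mu]_x g i x - c ord0 i / lm) * t - (2 * lm)^-1 * t ^+ 2 <=
    rpressure (fun x => comb c x + t * g i x).
  pose d : 'rV[R]_m := c + t *: delta_mx ord0 i.
  have dj j : d ord0 j = c ord0 j + t * (j == i)%:R by rewrite !mxE eqxx.
  have split_sum (G : 'I_m -> R) : \sum_(j < m) d ord0 j * G j =
      \sum_(j < m) c ord0 j * G j + t * G i.
    under eq_bigr do rewrite dj mulrDl; rewrite big_split/=; congr (_ + _).
    rewrite (bigD1 i)//= eqxx mulr1 big1 ?addr0// => j /negPf ->.
    by rewrite mulr0 mul0r.
  have sum_sq : \sum_(j < m) d ord0 j ^+ 2 =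
      \sum_(j < m) c ord0 j ^+ 2 + (2 * c ord0 i * t + t ^+ 2).
    rewrite (bigD1 i)//= [in RHS](bigD1 i)//= dj eqxx mulr1.
    rewrite (eq_bigr (fun j => c ord0 j ^+ 2)); last first.
      by move=> j /negPf ji; rewrite dj ji mulr0 addr0.
    by ring.
  have aux (p p' s1 s2 y q r : R) :
      p - s1 + s2 <= p' - (s1 + t * y) + (s2 + (q * t + r * t ^+ 2)) ->
      p + (y - q) * t - r * t ^+ 2 <= p' by lra.
  have := cmin d; rewrite /J split_sum sum_sq.
  rewrite (_ : comb d = fun x => comb c x + t * g i x); last first.
    by apply/funext => x; exact: split_sum.
  have divE S : (S + (2 * c ord0 i * t + t ^+ 2)) / (2 * lm) =
      S / (2 * lm) + (c ord0 i / lm * t + (2 * lm)^-1 * t ^+ 2).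
    by field; rewrite gt_eqF.
  rewrite divE; exact: aux.
apply/eqP; rewrite eq_le; apply/andP; split; last first.
  by apply: (tangent (Vcomb c) (Vg i)) => t t0; exact: step.
(* As [tangent] yields only a lower bound, the opposite inequality comes from the direction [- g i]
   and [step] at [- t]. *)
have := @tangent (comb c) (fun x => -1 * g i x) (- (\int[mu]_x g i x - c ord0 i / lm))
  (2 * lm)^-1 (Vcomb c) (VZ (-1) (Vg i)).
rewrite Rintegral_contZ// mulN1r lerN2; apply => t t0.
have := step (- t); rewrite sqrrN mulrN mulNr.
under [X in _ <= rpressure X -> _]eq_fun do rewrite mulNr -mulrN -mulN1r.
by [].
Qed.

End quadratic_minimization.

Theorem equilibrium_approximation (m : nat) (g : 'I_m -> T -> R) (mu : prob) (e : R) :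
  (forall i, V (g i)) -> tau_invariant tau mu -> 0 < e ->
  exists (v : T -> R) (nu : prob),
    [/\ V v, equilibrium_state tau (fun x => f x + v x) nu,
        forall i, `|\int[nu]_x g i x - \int[mu]_x g i x| <= e &
        \int[mu]_x f x + rentropy mu <= \int[nu]_x f x + rentropy nu].
Proof.
move=> Vg imu e0.
pose B := rpressure (fun=> 0) - (\int[mu]_x f x + rentropy mu).
have B0 : 0 <= B.
  have := le_rpressure V0 imu; rewrite Rintegral_prob_cst addr0.
  by rewrite -subr_ge0.
(* The squares of the [c i / lm] are at most [2 * B / lm], which this choice keeps below [e ^+ 2];
   the added 1 covers [B = 0]. *)
pose lm := 2 * B / e ^+ 2 + 1.
have e20 : 0 < e ^+ 2 by rewrite exprn_gt0.
have lm0 : 0 < lm by rewrite ltr_wpDl// divr_ge0 ?mulr_ge0// ltW.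
have lmE : e ^+ 2 * lm = 2 * B + e ^+ 2.
  by rewrite /lm mulrDr mulr1 mulrCA divff ?mulr1// gt_eqF.
have [c [Vc c_le cE]] := quadratic_minimizer Vg imu lm0.
set v := fun x => _ in Vc cE; exists v, (st v).
have cg i : continuous (g i) by exact: cV.
have sq_le : \sum_(i < m) c ord0 i ^+ 2 <= B * (2 * lm).
  by rewrite -ler_pdivrMr ?mulr_gt0// /B lerBrDl.
split=> [||i|]; [exact: Vc|exact: st_eq|..].
- rewrite cE addrAC subrr add0r normrN.
  rewrite -(@ler_pXn2r _ 2) ?nnegrE ?normr_ge0 ?(ltW e0)// real_normK ?num_real//.
  rewrite expr_div_n ler_pdivrMr ?exprn_gt0//.
  apply: le_trans (_ : B * (2 * lm) <= _); last first.
    by rewrite [lm ^+ 2]expr2 [leRHS]mulrA lmE; have := mulr_ge0 (ltW e20) (ltW lm0); lra.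
  apply: le_trans sq_le; rewrite (bigD1 i)//= lerDl.
  by apply: sumr_ge0 => j _; exact: sqr_ge0.
- have aux (a b h1 h2 s q : R) :
      0 <= q -> a + s + h1 <= b + (s - q) + h2 -> a + h1 <= b + h2 by lra.
  have vE (eta : prob) : \int[eta]_x v x = \sum_(i < m) c ord0 i * \int[eta]_x g i x.
    exact: (Rintegral_cont_sum compactT eta (c ord0) cg).
  have := le_rpressure Vc imu; rewrite (rpressureE Vc) !vE.
  (* The integral of [v] drops by a nonnegative amount from [mu] to [st v], so the remaining terms
     cannot decrease. *)
  have -> : \sum_(i < m) c ord0 i * \int[st v]_x g i x =
      \sum_(i < m) c ord0 i * \int[mu]_x g i x - (\sum_(i < m) c ord0 i ^+ 2) / lm.
    by rewrite mulr_suml -sumrB; apply: eq_bigr => i _; rewrite cE; ring.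
  apply: aux.
  by rewrite divr_ge0 ?(ltW lm0)// sumr_ge0// => i _; exact: sqr_ge0.
Qed.

End equilibrium.

(** * Weak-* convergence *)

Section compact_pseudometric.
Context {R : realType} {T : pseudoPMetricType R}.
Hypothesis compactT : compact [set: T].

(** Heine-Cantor, through the near-covering form of compactness. *)
Lemma compact_uniformly_continuous (g : T -> R) (e : R) : continuous g -> 0 < e ->
  exists2 r : R, 0 < r & forall x y, ball x r y -> `|g x - g y| <= e.
Proof.
move=> cg e0.
have : \forall r \near 0^'+, [set: T] `<=`
    [set x | forall y, ball x r y -> `|g x - g y| <= e].
  apply: ((compact_near_coveringP _).1 compactT) => x _.
  have e2 : 0 < e / 2 by rewrite divr_gt0.
  have /cvgrPdist_lt/(_ _ e2) := cg x.
  move=> /nbhs_ballP[d /= d0 dg]; have d2 : 0 < d / 2 by rewrite divr_gt0.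
  near=> x' r => /= y x'y.
  have xx' : ball x (d / 2) x' by near: x'; exact: near_ball.
  have rd : r <= d / 2 by near: r; exact: nbhs_right_le.
  have xd : ball x d x' by apply: le_ball xx'; lra.
  have yd : ball x d y.
    by rewrite [d]splitr; apply: ball_triangle xx' _; exact: le_ball x'y.
  have /= h1 := dg _ xd; have /= h2 := dg _ yd.
  rewrite (_ : g x' - g y = (g x - g y) - (g x - g x')); last by ring.
  by rewrite (le_trans (ler_normB _ _))//; lra.
move=> unif; near (0 : R)^'+ => r; exists r.
  by near: r; exact: nbhs_right_gt.
have h : [set: T] `<=` [set x | forall y, ball x r y -> `|g x - g y| <= e].
  by near: r.
by move=> x; exact: h.
Unshelve. all: by end_near. Qed.

Lemma partition_of_unity (r : R) : 0 < r ->
  exists (m : nat) (z : 'I_m -> T) (psi : 'I_m -> T -> R),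
    [/\ forall i, continuous (psi i), forall i x, 0 <= psi i x,
        forall x, \sum_(i < m) psi i x = 1 &
        forall i x, psi i x != 0 -> ball (z i) r x].
Proof.
(* The bump [b z] is 1 at [z] and vanishes on the closed set [B z]. Finitely many bumps have
   positive sum everywhere, and dividing by this sum normalizes them. *)
move=> r0; pose B (z : T) := ~` (ball z r)°.
pose b (z x : T) : R := 1 - Urysohn [set z] (B z) x.
have cb z : continuous (b z).
  by move=> x; apply: cvgB; [exact: cvg_cst|exact: Urysohn_continuous].
have sep z : uniform_separator [set z] (B z).
  apply: (@point_uniform_separator R); first exact/open_closedC/open_interior.
  by apply; exact: nbhsx_ballx.
have b_ge0 z x : 0 <= b z x.
  rewrite subr_ge0; have : `[0, 1]%classic (Urysohn [set z] (B z) x : R).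
    by apply: Urysohn_range; exists x.
  by rewrite /= in_itv/= => /andP[].
have bzz z : b z z = 1.
  apply/eqP; rewrite /b subr_eq addrC -subr_eq subrr eq_sym; apply/eqP.
  by apply: (Urysohn_sub0 (sep z)); exists z.
have b_supp z x : b z x != 0 -> ball z r x.
  apply: contraNP => zx; rewrite /b subr_eq0 eq_sym; apply/eqP.
  apply: (Urysohn_sub1 (sep z)); exists x => //.
  by apply: contra_not zx; exact: interior_subset.
have := compactT; rewrite compact_cover => /(_ T setT (fun z => [set x | 0 < b z x])).
case=> [z _|x _|D _ covD].
- by have /continuousP/(_ _ (@open_gt R 0)) := cb z.
- by exists x => //=; rewrite bzz.
pose s := enum_fset D; pose S x := \sum_(z <- s) b z x.
have S0 x : 0 < S x.
  have [z /= zD bz] := covD x I.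
  rewrite /S (big_rem z)//= ltr_pwDl//.
  by apply: sumr_ge0 => y _; exact: b_ge0.
have cS : continuous S by move=> x; apply: cvg_sumr => z; exact: cb.
exists (size s), (fun i => nth point s i), (fun i x => b (nth point s i) x / S x); split.
- move=> i x; apply: cvgM; first exact: cb.
  by apply: cvgV; [rewrite gt_eqF// S0|exact: cS].
- by move=> i x; rewrite divr_ge0 ?b_ge0 ?(ltW (S0 x)).
- move=> x; rewrite -mulr_suml -(big_mkord xpredT (fun i => b (nth point s i) x)).
  by rewrite -(big_nth point xpredT (fun z => b z x)) divff// (gt_eqF (S0 x)).
- by move=> i x; rewrite mulf_eq0 negb_or => /andP[bi _]; exact: b_supp.
Qed.

(** Replacing [g] by the combination of the [psi i] with weights [g (z i)] costs [e] for each
    measure; the [m] remaining terms differ by at most [M * d] each. *)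
Lemma partition_Rintegral_dist (P Q : probability (borel T) R) (m : nat)
    (z : 'I_m -> T) (psi : 'I_m -> T -> R) (r e d M : R) (g : T -> R) :
  (forall i, continuous (psi i)) -> (forall i x, 0 <= psi i x) ->
  (forall x, \sum_(i < m) psi i x = 1) ->
  (forall i x, psi i x != 0 -> ball (z i) r x) ->
  (forall i, `|\int[P]_x psi i x - \int[Q]_x psi i x| <= d) ->
  continuous g -> (forall x, `|g x| <= M) ->
  (forall x y, ball x r y -> `|g x - g y| <= e) ->
  `|\int[P]_x g x - \int[Q]_x g x| <= 2 * e + M * (m%:R * d).
Proof.
move=> cpsi psi0 psi1 psir PQ cg gM ge.
pose G x := \sum_(i < m) g (z i) * psi i x.
have cG : continuous G.
  by move=> x; apply: cvg_sumr => i; apply: cvgMr; exact: cpsi.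
have gG x : `|g x - G x| <= e.
  rewrite -[g x]mulr1 -(psi1 x) mulr_sumr -sumrB -[e]mulr1 -(psi1 x) mulr_sumr.
  apply: (le_trans (ler_norm_sum _ _ _)); apply: ler_sum => i _.
  rewrite -mulrBl normrM (ger0_norm (psi0 i x)).
  have [->|/psir zx] := eqVneq (psi i x) 0; first by rewrite !mulr0.
  by apply: ler_wpM2r => //; rewrite distrC; exact: ge.
have GE (mu : probability (borel T) R) :
    \int[mu]_x G x = \sum_(i < m) g (z i) * \int[mu]_x psi i x.
  exact: (Rintegral_cont_sum compactT mu (fun i => g (z i)) cpsi).
have GPQ : `|\int[P]_x G x - \int[Q]_x G x| <= M * (m%:R * d).
  rewrite !GE -sumrB (le_trans (ler_norm_sum _ _ _))//.
  apply: (@le_trans _ _ (\sum_(i < m) M * d)); last first.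
    by rewrite sumr_const card_ord mulrCA [leRHS]mulr_natl.
  apply: ler_sum => i _; rewrite -mulrBr normrM.
  by apply: ler_pM => //; exact: gM.
have hP := Rintegral_cont_dist compactT P cg cG gG.
have hQ := Rintegral_cont_dist compactT Q cg cG gG.
rewrite (_ : \int[P]_x g x - \int[Q]_x g x = (\int[P]_x g x - \int[P]_x G x) +
  (\int[P]_x G x - \int[Q]_x G x) - (\int[Q]_x g x - \int[Q]_x G x)); last by ring.
apply: (le_trans (ler_normB _ _)); apply: (le_trans (lerD (ler_normD _ _) (lexx _))).
have aux (a b c y : R) : a <= e -> b <= y -> c <= e -> a + b + c <= 2 * e + y by lra.
exact: aux.
Qed.

End compact_pseudometric.

(** The partition of unity at stage [n] depends on [n] alone, so a single sequence of states handles
    every continuous function. *)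
Lemma weak_star_approximation (R : realType) (Omega : pseudoPMetricType R)
  (k : acting_monoid) (l : nat) (tau : lat k l -> Omega -> Omega)
  (f : Omega -> R) (V : set (Omega -> R)) :
  hausdorff_space Omega -> compact [set: Omega] ->
  (forall a, continuous (tau a)) ->
  (forall mu : probability (borel Omega) R, tau_invariant tau mu ->
    ms_entropy tau mu \is a fin_num) ->
  entropy_usc R tau -> continuous f -> dense_subspace_C V ->
  (forall g, V g -> unique_equilibrium_state tau (fun x => f x + g x)) ->
  forall mu : probability (borel Omega) R, tau_invariant tau mu ->
  exists (mu_ : nat -> probability (borel Omega) R) (g_ : nat -> Omega -> R),
  [/\ forall n, V (g_ n) /\ equilibrium_state tau (fun x => f x + g_ n x) (mu_ n),
      forall g, continuous g -> \int[mu_ n]_x g x @[n --> \oo] --> \int[mu]_x g x &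
      forall n, \int[mu]_x f x + rentropy tau mu <=
        \int[mu_ n]_x f x + rentropy tau (mu_ n)].
Proof.
move=> hO cO ctau fin usc cf [V0 VD VZ cV dV] uniq mu imu.
pose stage n (p : (Omega -> R) * probability (borel Omega) R) :=
  [/\ V p.1, equilibrium_state tau (fun x => f x + p.1 x) p.2,
      \int[mu]_x f x + rentropy tau mu <= \int[p.2]_x f x + rentropy tau p.2 &
      forall (g : Omega -> R) (e M : R), continuous g -> (forall x, `|g x| <= M) ->
        (forall x y, ball x (n.+1%:R^-1) y -> `|g x - g y| <= e) ->
        `|\int[p.2]_x g x - \int[mu]_x g x| <= 2 * e + M * (3 * n.+1%:R^-1)].
have /choice[p p_stage] : forall n, exists p, stage n p.
  move=> n; have r0 : 0 < n.+1%:R^-1 :> R by rewrite invr_gt0.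
  have [m [z [psi [cpsi psi0 psi1 psir]]]] := partition_of_unity cO r0.
  (* The [m] errors of size [3 * d] then total at most [3 / (n + 1)]. *)
  pose d : R := n.+1%:R^-1 / m.+1%:R.
  have d0 : 0 < d by rewrite divr_gt0.
  have /choice[v v_psi] : forall i, exists v, V v /\ forall x, `|psi i x - v x| < d.
    by move=> i; have [v Vv vd] := dV _ (cpsi i) _ d0; exists v.
  have Vv i : V (v i) by case: (v_psi i).
  have cv i : continuous (v i) by exact: cV.
  have [g [nu [Vg enu nu_v nu_ent]]] := equilibrium_approximation
    hO cO ctau fin usc cf VD VZ V0 cV uniq Vv imu d0.
  exists (g, nu); split=> //= h e M ch hM he.
  (* One [d] for replacing [psi i] by [v i] under each measure, one for the approximation itself. *)
  have psi_nu i : `|\int[nu]_x psi i x - \int[mu]_x psi i x| <= 3 * d.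
    have psi_v x : `|psi i x - v i x| <= d by apply: ltW; case: (v_psi i).
    have h1 := Rintegral_cont_dist cO nu (cpsi i) (cv i) psi_v.
    have h2 := Rintegral_cont_dist cO mu (cpsi i) (cv i) psi_v.
    have aux (a b a' b' : R) : `|a - a'| <= d -> `|b - b'| <= d -> `|a' - b'| <= d ->
        `|a - b| <= 3 * d by rewrite !ler_norml; lra.
    exact: aux h1 h2 (nu_v i).
  apply: (le_trans (partition_Rintegral_dist cO cpsi psi0 psi1 psir psi_nu ch hM he)).
  rewrite lerD2l ler_wpM2l ?(le_trans _ (hM point))//.
  rewrite mulrCA ler_wpM2l// /d mulrCA ler_piMr ?(ltW r0)//.
  by rewrite ler_pdivrMr// mul1r ler_nat.
exists (fun n => (p n).2), (fun n => (p n).1); split=> [n|g cg|n]; last 1 first.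
- by have [] := p_stage n.
- by have [] := p_stage n.
apply/cvgrPdist_lt => e e0.
have [M gM] := continuous_compact_bounded cO cg.
have M0 : 0 <= M := le_trans (normr_ge0 _) (gM point).
have e4 : 0 < e / 4 by rewrite divr_gt0.
have [r r0 gr] := compact_uniformly_continuous cO cg e4.
(* Below this mesh the term [M * (3 / (n + 1))] is less than [e / 2]; [M + 1] avoids dividing by
   0. *)
have q0 : 0 < e / (6 * (M + 1)) by rewrite divr_gt0// mulr_gt0// ltr_wpDl.
near=> n; have [_ _ _ /(_ g (e / 4) M cg gM)] := p_stage n.
have nr : n.+1%:R^-1 < r.
  by near: n; have /cvgrPdist_lt/(_ _ r0) := @cvg_harmonic R;
    apply: filterS => n /=; rewrite sub0r normrN ger0_norm.
have nq : n.+1%:R^-1 < e / (6 * (M + 1)).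
  by near: n; have /cvgrPdist_lt/(_ _ q0) := @cvg_harmonic R;
    apply: filterS => n /=; rewrite sub0r normrN ger0_norm.
rewrite distrC => /(_ _)/le_lt_trans; apply.
  by move=> x y xy; apply: gr; apply: le_ball xy; exact: ltW.
have aux (a b : R) : a <= b -> b < e / 2 -> 2 * (e / 4) + a < e by lra.
apply: (aux _ (M * (3 * (e / (6 * (M + 1)))))).
  by rewrite ler_wpM2l// ler_wpM2l// ltW.
rewrite (_ : M * _ = M / (M + 1) * (e / 2)); last first.
  by field; rewrite gt_eqF// ltr_wpDl.
by rewrite gtr_pMl ?divr_gt0// ltr_pdivrMr ?mul1r ?ltrDl// ltr_wpDl.
Unshelve. all: by end_near. Qed.

Theorem theorem1 (R : realType) (Omega : pseudoPMetricType R)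
  (k : acting_monoid) (l : nat) (tau : lat k l -> Omega -> Omega)
  (f : Omega -> R) (V : set (Omega -> R)) :
  hausdorff_space Omega -> compact [set: Omega] -> (0 < l)%N ->
  is_action tau ->
  (forall mu : probability (borel Omega) R, tau_invariant tau mu -> ms_entropy tau mu \is a fin_num) ->
  entropy_usc R tau ->
  continuous f ->
  dense_subspace_C V ->
  (forall g, V g -> unique_equilibrium_state tau (fun x => f x + g x)) ->
  forall mu : probability (borel Omega) R, tau_invariant tau mu ->
  exists (mu_ : nat -> probability (borel Omega) R) (g_ : nat -> Omega -> R),
    [/\ (forall n, [/\ tau_invariant tau (mu_ n), V (g_ n) &
                     equilibrium_state tau (fun x => f x + g_ n x) (mu_ n)]),
        weak_star_cvg mu_ mu &
        (fun n => ms_entropy tau (mu_ n)) @ \oo --> ms_entropy tau mu].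
Proof.
move=> hO cO _ [ctau _ _] fin usc cf dV uniq mu imu.
have [mu_ [g_ [eq_mu mu_mu ent_ge]]] :=
  weak_star_approximation hO cO ctau fin usc cf dV uniq imu.
have imu_ n : tau_invariant tau (mu_ n) by have [_ []] := eq_mu n.
exists mu_, g_; split=> [n|g cg|].
- by have [] := eq_mu n; split.
- rewrite pairing_Rintegral//; under eq_cvg do rewrite pairing_Rintegral//.
  by apply: cvg_EFin; [exact: nearW|exact: mu_mu].
rewrite (rentropyE fin imu); under eq_cvg do rewrite (rentropyE fin (imu_ _)).
apply: cvg_EFin; first exact: nearW.
apply/cvgrPdist_lt => e e0.
have ent_e : rentropy tau mu < rentropy tau mu + e by rewrite ltrDl.
(* Semi-continuity bounds the entropies from above; [ent_ge] with convergence of the integrals of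
   [f] bounds them from below. *)
have ub := rentropy_near_lt cO fin usc eventually_filter imu_ imu mu_mu ent_e.
have /cvgrPdist_lt/(_ _ e0) f_near := mu_mu f cf.
near=> n.
have ub_n : rentropy tau (mu_ n) < rentropy tau mu + e by near: n.
have f_n : `|\int[mu]_x f x - \int[mu_ n]_x f x| < e by near: n.
have aux (a b c d : R) : a + b <= c + d -> d < b + e -> `|a - c| < e -> `|b - d| < e.
  by rewrite !ltr_norml; lra.
exact: aux (ent_ge n) ub_n f_n.
Unshelve. all: by end_near. Qed.
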